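(* There is a family of MDPs $\langle M(n) \mid n \in \mathbb{N}\rangle$, where $M(n)$ has $n$ states and encoding size $O(n)$, together with two sets of states $P_1, P_2$ of $M(n)$ and an initial state $u$, such that the Pareto curve of the achievable set for the two reachability objectives $\Diamond P_1$ and $\Diamond P_2$ (maximize the probability of eventually reaching $P_1$, resp. $P_2$) contains $n^{\Omega(\log n)}$ vertices (and thus $n^{\Omega(\log n)}$ facets).
   Context: A finite MDP $M=(V,\Gamma,\delta)$ has a finite state set $V$, an action alphabet $\Gamma$, for each state $v$ a nonempty set $\Gamma_v\subseteq\Gamma$ of enabled actions, and for each $v$, $\gamma\in\Gamma_v$ a probability distribution $p_{(v,\gamma,\cdot)}$ over $V$ with rational probabilities. Its encoding size $|M|$ is the total size needed to encode all transitions and their rational probabilities (numerators and denominators in binary) and state labels. A strategy $\sigma$ maps each finite history $w v\in(V\Gamma)^*V$ to a probability distribution over $\Gamma_v$; together with an initial state $u$ it induces a probability measure on runs, and $\Pr^\sigma_u(\Diamond P)$ denotes the probability of eventually visiting a state of $P\subseteq V$. For objectives $\varphi_1,\dots,\varphi_k$, let $t^\sigma=(\Pr^\sigma_u(\varphi_1),\dots,\Pr^\sigma_u(\varphi_k))$; the achievable set is $U=\{r\in\mathbb{R}_{\ge0}^k \mid \exists\sigma,\ t^\sigma\ge r\}$ (coordinatewise). A vector $v\in U$ is Pareto optimal if there is no $v'\in U$ with $v\le v'$ and $v\neq v'$; the Pareto curve is the set of Pareto optimal vectors of $U$ (a polyhedral surface, whose vertices and facets are meant here). *)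

(* Defs.v *)
From HB Require Import structures.
From mathcomp Require Import all_boot all_order all_algebra.
From mathcomp Require Import all_classical all_reals all_analysis.

Set Implicit Arguments.
Unset Strict Implicit.
Unset Printing Implicit Defensive.

Import Order.TTheory GRing.Theory Num.Theory.

Local Open Scope classical_set_scope.
Local Open Scope ring_scope.

(* [trans v a] is only meaningful when [a] is enabled in [v]. *)
Record mdp := Mdp {
  state : finType;
  action : finType;
  enabled : state -> {set action};
  trans : state -> action -> state -> rat;
  state_gt0 : (0 < #|state|)%N;
  enabled_neq0 : forall v, enabled v != finset.set0;
  trans_ge0 : forall v a w, a \in enabled v -> 0 <= trans v a w;
  trans_sum1 : forall v a, a \in enabled v -> \sum_w trans v a w = 1
}.

Definition bitlen (n : nat) : nat := (trunc_log 2 n).+1.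

Definition rat_size (q : rat) : nat := (bitlen `|numq q| + bitlen `|denq q|)%N.

(* Size of [M] with states labelled by the propositions in [L].  A transition
   is a triple of nonzero probability.  It costs one unit plus the bits of its
   probability: state and action names count as unit-size symbols, as they
   must, since n states that are named in binary take more than O(n) bits.  A
   state costs one unit plus one bit for each proposition of its label. *)
Definition mdp_size (M : mdp) (L : seq {set state M}) : nat :=
  (\sum_(v : state M) (1 + size L)
   + \sum_(v : state M) \sum_(a in enabled v)
       \sum_(w : state M | (trans v a w != 0)%R) (1 + rat_size (trans v a w)))%N.

Section Runs.
Variable M : mdp.

(* [(w, v)] is the history w v, with w in (V Gamma)^* and v in V. *)
Definition history : Type := (seq (state M * action M) * state M)%type.

(* The run v_0 a_0 v_1 a_1 ... is the sequence of the pairs (v_i, a_i). *)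
Definition run_seq : Type := nat -> state M * action M.

Lemma run_seq_inhabited : $| run_seq |.
Proof.
have /card_gt0P[v _] := state_gt0 M.
have /set0Pn[a _] := enabled_neq0 v.
exact: squash (fun=> (v, a)).
Qed.

HB.instance Definition _ :=
  Choice.copy run_seq (nat -> (state M * action M)%type).
HB.instance Definition _ := isPointed.Build run_seq (unsquash run_seq_inhabited).

(* The i-th state of the history; the default value of [nth] makes the state of
   index [size h.1] be [h.2]. *)
Definition hist_state (h : history) (i : nat) : state M :=
  nth h.2 (unzip1 h.1) i.

Definition cylinder (h : history) : set run_seq :=
  [set r : run_seq | (forall i : 'I_(size h.1), r i = tnth (in_tuple h.1) i) /\
           (r (size h.1)).1 = h.2].

Definition run : Type := g_sigma_algebraType (range cylinder).

Definition reach (P : {set state M}) : set run :=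
  [set r : run | exists i, (r i).1 \in P].

End Runs.

Record strategy (R : realType) (M : mdp) := Strategy {
  strat_prob : history M -> action M -> R;
  strat_ge0 : forall h a, 0 <= strat_prob h a;
  strat_sum1 : forall h, \sum_a strat_prob h a = 1;
  strat_enabled : forall h a, a \notin enabled h.2 -> strat_prob h a = 0
}.

Section Achievable.
Variables (R : realType) (M : mdp).

Definition hist_prob (sigma : strategy R M) (u : state M) (h : history M) : R :=
  (hist_state h 0 == u)%:R *
  \prod_(i < size h.1)
    let: (v, a) := tnth (in_tuple h.1) i in
    strat_prob sigma (take i h.1, v) a * ratr (trans v a (hist_state h i.+1)).

(* [mu] is the measure on runs induced by [sigma] and [u]; its values on
   cylinders determine it. *)
Definition induced_measure (sigma : strategy R M) (u : state M)
    (mu : probability (run M) R) : Prop :=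
  forall h, mu (cylinder h) = (hist_prob sigma u h)%:E.

Definition achievable (u : state M) (k : nat) (phi : k.-tuple (set (run M))) :
    set 'rV[R]_k :=
  [set r | (forall i, 0 <= r 0 i) /\
     exists (sigma : strategy R M) (mu : probability (run M) R),
       induced_measure sigma u mu /\
       forall i, ((r 0 i)%:E <= mu (tnth phi i))%E].

End Achievable.

Section Pareto.
Variables (R : realType) (k : nat).
Implicit Types (U F : set 'rV[R]_k) (x v : 'rV[R]_k).

Definition pareto_curve U : set 'rV[R]_k :=
  [set v | U v /\
     ~ exists v', [/\ U v', forall i, v 0 i <= v' 0 i & v <> v']].

(* The set where a valid inequality a.x <= b, with a <> 0, is tight. *)
Definition face U F : Prop :=
  exists (a : 'rV[R]_k) (b : R),
    [/\ a != 0,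
        forall x, U x -> \sum_i a 0 i * x 0 i <= b &
        F = [set x | U x /\ \sum_i a 0 i * x 0 i = b]].

(* A facet is a face of dimension k - 1, that is, with k affinely independent
   points: the vectors (x_i, 1) are linearly independent. *)
Definition facet U F : Prop :=
  face U F /\
  exists x : 'I_k -> 'rV[R]_k,
    (forall i, F (x i)) /\
    row_free (\matrix_(i < k) row_mx (x i) (1%:M : 'M[R]_1)).

Definition pareto_vertices U : set 'rV[R]_k :=
  [set v | pareto_curve U v /\ face U [set v]].

Definition pareto_facets U : set (set 'rV[R]_k) :=
  [set F | facet U F /\ F `<=` pareto_curve U].

End Pareto.

Definition card_ge (R : realType) (T : Type) (A : set T) (x : R) : Prop :=
  exists m : nat, x <= m%:R /\ (`I_m #<= A)%card.

(* Main.v *)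
Require Import Defs.
From HB Require Import structures.
From mathcomp Require Import all_boot all_order all_algebra.
From mathcomp Require Import all_classical all_reals all_analysis.
From mathcomp Require Import zify ring lra.

Set Implicit Arguments.
Unset Strict Implicit.
Unset Printing Implicit Defensive.
Import Order.TTheory GRing.Theory Num.Theory.
Import numFieldNormedType.Exports.
Local Open Scope classical_set_scope.
Local Open Scope ring_scope.

(** Weighting the two objectives by [l] and [1 - l], the optimal value at the
    root is the support function of the achievable set, and a strict kink of it
    at a weight in ]0, 1[ gives a facet of the Pareto curve together with a
    vertex at its end.  It thus suffices to produce many kinks.

    Let A_0 be in P1 only, B_0 in P2 only, and C_0 in both.  At A_(k+1) the
    player chooses A_k or B_k and moves there with probability 4/5; B_(k+1)
    moves to A_k, B_k, C_k with probabilities 2/5, 2/5, 1/5; C_(k+1) moves to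
    C_k with probability 1/5; the remaining mass is lost.  After scaling by 5^k
    the optimal values satisfy a' = 4 max(a, b) and b' = 2 a + 2 b + 1, so the
    difference d = a - b follows the tent map d' = 2 |d| - 1, starting from
    2 l - 1.  Hence d_k has 2^k zeros, and each of them is a kink of a_(k+1):
    linearly many states already give exponentially many facets.

    Since the process is absorbed, the measure of a memoryless deterministic
    policy is a finite average of Dirac measures. *)

(** * Zeros of the iterated tent map, and kinks of the value functions *)

Section TentMap.
Variable R : realType.
Implicit Types l x y : R.

Definition tent x : R := 2 * `|x| - 1.

Lemma iter_tent1 k : iter k tent 1 = 1.
Proof. by elim: k => //= k ->; rewrite /tent normr1; ring. Qed.

(** An orbit that hits 0 continues with -1, 1, 1, ... and never returns to 0. *)
Lemma iter_tent_neq0 k j x : (j < k)%N -> iter k tent x = 0 ->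
  iter j tent x != 0.
Proof.
move=> jk xk; apply/eqP => xj; move: xk.
rewrite -(subnK jk) iterD iterS xj.
have -> : tent 0 = -1 by rewrite /tent normr0; ring.
case: (k - j.+1)%N => [|i] /=; first lra.
by rewrite -iterS iterSr /tent normrN1 -/(tent _) (_ : 2 * 1 - 1 = 1) ?iter_tent1; lra.
Qed.

(** The preimages of [x] under [tent] are (1 + x) / 2 and its opposite, so each level lists the
    preimages of the previous one. *)
Fixpoint tent_zeros k : seq R :=
  if k is j.+1 then
    [seq (1 + x) / 2 | x <- tent_zeros j] ++
    [seq - ((1 + x) / 2) | x <- tent_zeros j]
  else [:: 0].

Lemma size_tent_zeros k : size (tent_zeros k) = (2 ^ k)%N.
Proof. by elim: k => //= k IH; rewrite size_cat !size_map IH expnS mul2n addnn. Qed.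

Lemma tent_zeros_itv k x : x \in tent_zeros k -> -1 < x < 1.
Proof.
elim: k x => [|k IH] x /=; first by rewrite inE => /eqP ->; lra.
by rewrite mem_cat => /orP[] /mapP[y /IH yP ->]; lra.
Qed.

Lemma iter_tent_zeros k x : x \in tent_zeros k -> iter k tent x = 0.
Proof.
elim: k x => [|k IH] x; first by rewrite inE => /eqP ->.
rewrite /= -iterS iterSr mem_cat => xk.
suff [y yk ->] : exists2 y, y \in tent_zeros k & tent x = y by exact: IH.
case/orP: xk => /mapP[y yk ->]; exists y => //; have := tent_zeros_itv yk.
  by move=> ?; rewrite /tent ger0_norm; lra.
by move=> ?; rewrite /tent normrN ger0_norm; lra.
Qed.

Lemma tent_zeros_uniq k : uniq (tent_zeros k).
Proof.
elim: k => //= k IH; rewrite cat_uniq !map_inj_uniq ?IH ?andbT /=.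
- apply/hasPn => x /mapP[y yk ->]; apply/mapP => -[z zk].
  by have := tent_zeros_itv yk; have := tent_zeros_itv zk; lra.
- by move=> y z; lra.
- by move=> y z; lra.
Qed.

(* [5 ^+ k] times the optimal values at the states A_k and B_k, for the
   weights [l] and [1 - l] of the two objectives. *)
Fixpoint scaled_values k l : R * R :=
  if k is j.+1 then
    let: (a, b) := scaled_values j l in (4 * Num.max a b, 2 * a + 2 * b + 1)
  else (l, 1 - l).

Definition scaled_gap k l := (scaled_values k l).1 - (scaled_values k l).2.

Lemma scaled_gapE k l : scaled_gap k l = iter k tent (2 * l - 1).
Proof.
rewrite /scaled_gap; elim: k => [|k] /=; first ring.
case: (scaled_values k l) => a b /= <-; rewrite /tent.
by case: (leP a b) => ab; [rewrite ler0_norm|rewrite gtr0_norm]; lra.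
Qed.

(** As long as no earlier gap vanishes at [l], the same argument wins each maximum near [l], so both
    values are affine there. One step multiplies the difference of the two slopes by 2 or -2, so the
    slopes stay distinct. *)
Lemma scaled_values_affine k l : (forall j, (j < k)%N -> scaled_gap j l != 0) ->
  exists e sa sb : R, [/\ 0 < e, sa != sb & forall y, `|y - l| <= e ->
    (scaled_values k y).1 = (scaled_values k l).1 + sa * (y - l) /\
    (scaled_values k y).2 = (scaled_values k l).2 + sb * (y - l)].
Proof.
elim: k => [_|k IH gap_neq0].
  by exists 1, 1, (-1); split => [//||y _ /=]; [by apply/eqP => ?; lra|split; ring].
have [j jk|e [sa [sb [e0 sab affP]]]] := IH; first exact/gap_neq0/ltnW.
have := gap_neq0 k (ltnSn k); rewrite /scaled_gap => gap0.
set ga := _ - _ in gap0.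
have dab0 : 0 < `|sa - sb| by rewrite normr_gt0 subr_eq0.
have near0 y : `|y - l| <= `|ga| / `|sa - sb| -> `|(sa - sb) * (y - l)| <= `|ga|.
  by move=> ?; rewrite normrM mulrC -ler_pdivlMr.
(* Within this radius the gap moves by at most [|ga|], so it does not change sign. *)
pose e' := Num.min e (`|ga| / `|sa - sb|).
have e'0 : 0 < e' by rewrite lt_min e0 divr_gt0 // normr_gt0.
have near1 y : `|y - l| <= e' ->
  [/\ (scaled_values k y).1 = (scaled_values k l).1 + sa * (y - l),
      (scaled_values k y).2 = (scaled_values k l).2 + sb * (y - l) &
      `|(sa - sb) * (y - l)| <= `|ga|].
  by rewrite le_min => /andP[/affP[? ?] /near0].
have /orP[ga_lt0|ga_gt0] : (ga < 0) || (0 < ga) by rewrite -neq_lt.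
- exists e', (4 * sb), (2 * sa + 2 * sb); split=> //.
    by apply: contra_neq sab => ?; lra.
  move=> y /near1[]; rewrite /ga /= in ga_lt0 *.
  case: (scaled_values k y) (scaled_values k l) ga_lt0 => a b [a' b'] /= ga_lt0 -> ->.
  rewrite (ltr0_norm ga_lt0) ler_norml => /andP[? ?].
  rewrite !max_r; [split; ring|lra|lra].
- exists e', (4 * sa), (2 * sa + 2 * sb); split=> //.
    by apply: contra_neq sab => ?; lra.
  move=> y /near1[]; rewrite /ga /= in ga_gt0 *.
  case: (scaled_values k y) (scaled_values k l) ga_gt0 => a b [a' b'] /= ga_gt0 -> ->.
  rewrite (gtr0_norm ga_gt0) ler_norml => /andP[? ?].
  rewrite !max_l; [split; ring|lra|lra].
Qed.

Definition kink (f : R -> R) l := exists e s s' : R, [/\ 0 < e, s < s' &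
  forall t, 0 <= t <= e -> f (l - t) = f l - s * t /\ f (l + t) = f l + s' * t].

(** At this weight the level-[k] gap vanishes for the first time: two affine branches of distinct
    slopes cross, and their maximum turns from the smaller slope to the larger one. *)
Lemma scaled_values_kink k x : x \in tent_zeros k ->
  kink (fun l => (scaled_values k.+1 l).1) ((1 + x) / 2).
Proof.
move=> xk; set l := _ / 2.
have gapE j : scaled_gap j l = iter j tent x.
  by rewrite scaled_gapE; congr iter; rewrite /l; lra.
have [j jk|e [sa [sb [e0 sab affP]]]] := @scaled_values_affine k l.
  by rewrite gapE; exact: iter_tent_neq0 jk (iter_tent_zeros xk).
have gap0 : scaled_gap k l = 0 by rewrite gapE iter_tent_zeros.
exists e, (4 * Num.min sa sb), (4 * Num.max sa sb); split=> //.
  by rewrite ltr_pM2l //; case: (ltgtP sa sb) sab.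
move=> t /andP[t0 te].
have [|aE1 bE1] := affP (l - t).
  by rewrite addrAC subrr sub0r normrN ger0_norm.
have [|aE2 bE2] := affP (l + t).
  by rewrite addrAC subrr add0r ger0_norm.
move: aE1 bE1 aE2 bE2 gap0; rewrite /scaled_gap /=.
move: (scaled_values k (l - t)) (scaled_values k (l + t)) (scaled_values k l).
move=> [a1 b1] [a2 b2] [a b] /= -> -> -> -> /eqP; rewrite subr_eq0 => /eqP ->.
rewrite maxxx.
have -> : sa * (l - t - l) = - (sa * t) by ring.
have -> : sb * (l - t - l) = - (sb * t) by ring.
have -> : sa * (l + t - l) = sa * t by ring.
have -> : sb * (l + t - l) = sb * t by ring.
have [ab|ab|ab] := ltgtP sa sb; last by rewrite ab eqxx in sab.
  have ? : sa * t <= sb * t by rewrite ler_wpM2r // ltW.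
  by rewrite max_l ?max_r; lra.
have ? : sb * t <= sa * t by rewrite ler_wpM2r // ltW.
by rewrite max_r ?max_l; lra.
Qed.

End TentMap.

(** [Q i v] says that [v] is a witness for [i]. No [v] serves two indices, so any choice of
    witnesses is injective. *)
Lemma card_ge_seq (I : eqType) (T : Type) (s : seq I) (A : set T)
    (Q : I -> T -> Prop) :
  uniq s ->
  (forall i, i \in s -> exists v, A v /\ Q i v) ->
  {in s &, forall i j v, Q i v -> Q j v -> i = j} ->
  (`I_(size s) #<= A)%card.
Proof.
case: s => [|i0 s'] us exQ Qinj; first by rewrite II0 card_ge0.
set s := i0 :: s' in us exQ Qinj *.
have [v0 _] := exQ i0 (mem_head _ _).
have /choice[g gP] k : exists v, (k < size s)%N -> A v /\ Q (nth i0 s k) v.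
  by case: (ltnP k (size s)) => [/(mem_nth i0)/exQ[v]|_]; [exists v|exists v0].
suff /injfunPex[h] : exists2 h, set_fun `I_(size s) A h & set_inj `I_(size s) h.
  exact: inj_card_le h.
exists g => [k /gP[]//|].
move=> i j; rewrite !inE /= => si sj gij; apply/eqP.
rewrite -(@nth_uniq _ i0 s i j si sj us); apply/eqP.
have [_ Qi] := gP i si; have [_ Qj] := gP j sj.
by apply: (Qinj _ _ _ _ (g i)) => //; [exact: mem_nth..|rewrite gij].
Qed.

(** * From kinks of the support function to vertices and facets in the plane *)

Section PlanarPareto.
Variable R : realType.
Implicit Types (U : set 'rV[R]_2) (x v : 'rV[R]_2) (l t : R).

Definition weighted l x : R := l * x 0 0 + (1 - l) * x 0 1.

Definition slope x : R := x 0 0 - x 0 1.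

Lemma weightedD l t x : weighted (l + t) x = weighted l x + slope x * t.
Proof. rewrite /weighted /slope; ring. Qed.

(** The linear map sending [x] to its weight and its slope has determinant -1 for every [l]. *)
Lemma weighted_slope_inj l x v :
  weighted l x = weighted l v -> slope x = slope v -> x = v.
Proof.
rewrite /weighted /slope => xv sxv.
have {}xv : l * (x 0 0 - x 0 1) + x 0 1 = l * (v 0 0 - v 0 1) + v 0 1.
  by transitivity (l * x 0 0 + (1 - l) * x 0 1); [|rewrite xv]; ring.
have x1 : x 0 1 = v 0 1 by rewrite sxv in xv; exact: addrI xv.
apply/rowP => i; have [->|->] : i = 0 \/ i = 1; last exact: x1.
- by case: i => -[|[|//]] ?; [left|right]; exact: val_inj.
- by move: sxv; rewrite x1 => /addIr.
Qed.

Lemma weighted_sum l x :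
  \sum_i (\row_j (if j == 0 :> 'I_2 then l else 1 - l)) 0 i * x 0 i =
  weighted l x.
Proof. by rewrite big_ord_recl big_ord1 !mxE /=; congr (_ + _ * x _ _); exact: val_inj. Qed.

Variables (U : set 'rV[R]_2) (f : R -> R).
Hypothesis U_le : forall x l, U x -> 0 <= l <= 1 -> weighted l x <= f l.
Hypothesis U_attains : forall l, 0 <= l <= 1 -> exists2 x, U x & weighted l x = f l.

Definition support_set l : set 'rV[R]_2 := [set x | U x /\ weighted l x = f l].

(** Both weights are positive, so a dominating point whose weighted value does not exceed [f l]
    agrees with [x] in both coordinates. *)
Lemma support_pareto l : 0 < l < 1 -> support_set l `<=` pareto_curve U.
Proof.
move=> /andP[l0 l1] x [Ux xl]; split => // -[v [Uv xv neq]]; apply: neq.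
have vl : weighted l v <= f l by apply: U_le => //; lra.
have d0 : 0 <= l * (v 0 0 - x 0 0) by rewrite mulr_ge0 ?subr_ge0 // ltW.
have d1 : 0 <= (1 - l) * (v 0 1 - x 0 1) by rewrite mulr_ge0 ?subr_ge0 // ltW.
rewrite /weighted in xl vl.
have e0 : l * (v 0 0 - x 0 0) = 0 by lra.
have e1 : (1 - l) * (v 0 1 - x 0 1) = 0 by lra.
move/eqP: e0; rewrite mulf_eq0 gt_eqF //= => /eqP e0.
move/eqP: e1; rewrite mulf_eq0 gt_eqF ?subr_gt0 //= => /eqP e1.
by apply: (@weighted_slope_inj 0); rewrite /weighted /slope; lra.
Qed.

Lemma support_face l : 0 < l < 1 -> face U (support_set l).
Proof.
move=> l01; exists (\row_j (if j == 0 :> 'I_2 then l else 1 - l)), (f l); split.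
- apply/eqP => /rowP/(_ 0); rewrite !mxE /=; lra.
- by move=> x Ux; rewrite weighted_sum; apply: U_le => //; lra.
- by apply/seteqP; split => x /=; rewrite weighted_sum.
Qed.

(** As a function of the weight, the value of [x] is affine, stays below [f] and touches it at the
    midpoint of a segment where [f] is affine; so the slopes agree. *)
Lemma support_slope l e s : 0 < e -> 0 <= l - e -> l + e <= 1 ->
  f (l - e) = f l - s * e -> f (l + e) = f l + s * e ->
  forall x, support_set l x -> slope x = s.
Proof.
move=> e0 le0 le1 fl fr x [Ux xl].
have := @U_le x (l + e) Ux; have := @U_le x (l - e) Ux.
rewrite !weightedD fl fr xl mulrN => h1 h2; apply/eqP; rewrite eq_le.
rewrite -(ler_pM2r e0 (slope x)) -(ler_pM2r e0 s).
have {}h1 := h1 ltac:(lra); have {}h2 := h2 ltac:(lra).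
by apply/andP; split; lra.
Qed.

(** Optimal points for the weights [l - h] and [l + h] have the two one-sided slopes of [f], hence
    both remain optimal at [l]: they span an edge. At [l - h] the weighted value and the slope
    determine the point, so the left one is exposed. *)
Lemma kink_support l : 0 < l < 1 -> kink f l ->
  exists (xl xr : 'rV[R]_2) (l0 : R), [/\ support_set l xl, support_set l xr,
    slope xl < slope xr, 0 < l0 < 1 & support_set l0 = [set xl]].
Proof.
move=> l01 [e [s [s' [e0 ss' fP]]]].
(* The halving makes [l - h] and [l + h] midpoints of affine pieces of length [2 * h] that stay
   inside the unit interval. *)
pose h := Num.min e (Num.min l (1 - l)) / 2.
have h0 : 0 < h by rewrite divr_gt0 // !lt_min e0; lra.
have [he [hl h1]] : 2 * h <= e /\ 2 * h <= l /\ 2 * h <= 1 - l.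
  have : 2 * h <= Num.min e (Num.min l (1 - l)) by rewrite /h; lra.
  by rewrite !le_min => /and3P[].
have f0 t : 0 <= t <= 2 * h -> f (l - t) = f l - s * t /\ f (l + t) = f l + s' * t.
  by move=> ?; apply: fP; lra.
have [fl1 fr1] : f (l - h) = f l - s * h /\ f (l + h) = f l + s' * h by apply: f0; lra.
have [fl2 fr2] : f (l - 2 * h) = f l - s * (2 * h) /\
    f (l + 2 * h) = f l + s' * (2 * h) by apply: f0; lra.
have slopeL : forall x, support_set (l - h) x -> slope x = s.
  apply: (@support_slope _ h) => //; try lra.
  - by rewrite fl1 (_ : l - h - h = l - 2 * h) ?fl2; ring.
  - by rewrite fl1 (_ : l - h + h = l); ring.
have slopeR : forall x, support_set (l + h) x -> slope x = s'.
  apply: (@support_slope _ h) => //; try lra.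
  - by rewrite fr1 (_ : l + h - h = l); ring.
  - by rewrite fr1 (_ : l + h + h = l + 2 * h) ?fr2; ring.
have [|xl Ul xlE] := @U_attains (l - h); first lra.
have [|xr Ur xrE] := @U_attains (l + h); first lra.
have sl : slope xl = s by exact: slopeL.
have sr : slope xr = s' by exact: slopeR.
exists xl, xr, (l - h); split; last 2 first.
- lra.
- apply/seteqP; split => [x [Ux xE]|x -> //] /=.
  by apply: (@weighted_slope_inj (l - h)); rewrite ?sl ?slopeL ?xE.
- by split => //; move: xlE; rewrite weightedD fl1 sl; lra.
- by split => //; move: xrE; rewrite weightedD fr1 sr; lra.
- by rewrite sl sr.
Qed.

Variable ls : seq R.
Hypothesis ls_uniq : uniq ls.
Hypothesis ls_itv : {in ls, forall l, 0 < l < 1}.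
Hypothesis ls_kink : {in ls, forall l, kink f l}.

(** Each kink is charged to the endpoint of smaller slope of its edge. *)
Lemma kink_vertices : (`I_(size ls) #<= pareto_vertices U)%card.
Proof.
pose Q l xl := support_set l xl /\ exists2 xr, support_set l xr & slope xl < slope xr.
apply: (@card_ge_seq _ _ _ _ Q ls_uniq) => [l lls|].
  have [xl [xr [l0 [xlP xrP sP l0P fl]]]] := kink_support (ls_itv lls) (ls_kink lls).
  exists xl; split; last by split => //; exists xr.
  split; first by apply: (support_pareto (ls_itv lls)).
  by rewrite -fl; exact: support_face.
(* If [x] is optimal at both weights, then [v], which ties with [x] at [l] and has a larger slope,
   beats the optimum at [l']. *)
have QQ l l' x : l' \in ls -> Q l x -> Q l' x -> ~ l < l'.
  move=> l'ls [[Ux xl] [v [Uv vl] xv]] [[_ xl'] _] ll'.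
  have := @U_le v l' Uv; have /andP[? ?] := ls_itv l'ls.
  move=> /(_ ltac:(lra)); rewrite -xl' -(subrK l l') addrC !weightedD xl vl.
  have : slope x * (l' - l) < slope v * (l' - l) by rewrite ltr_pM2r // subr_gt0.
  by lra.
move=> l l' lls l'ls x xl xl'.
by have [/(QQ _ _ _ l'ls xl xl')|/(QQ _ _ _ lls xl' xl)|//] := ltgtP l l'.
Qed.

Lemma kink_facets : (`I_(size ls) #<= pareto_facets U)%card.
Proof.
pose Q l (F : set 'rV[R]_2) := F = support_set l /\
  exists x v, [/\ F x, F v & slope x < slope v].
apply: (@card_ge_seq _ _ _ _ Q ls_uniq) => [l lls|].
  have l01 := ls_itv lls.
  have [xl [xr [_ [xlP xrP sP _ _]]]] := kink_support l01 (ls_kink lls).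
  exists (support_set l); split; last by split => //; exists xl, xr.
  split; last exact: support_pareto.
  split; first exact: support_face.
  exists (fun i => if i == 0 then xl else xr); split; first by move=> i; case: ifP.
  apply/row_freeP; apply/row_freeP; rewrite -kermx_eq0; apply/rowV0P => c.
  move=> /sub_kermxP; rewrite mulmx_sum_row big_ord_recl big_ord1 !rowK /=.
  rewrite !scale_row_mx add_row_mx -[RHS]row_mx0 => /eq_row_mx[/rowP cx /rowP c1].
  have := cx 0; have := cx 1; have := c1 0; rewrite !mxE eqxx !mulr1.
  set i1 := lift _ _ => {}c1 cx1 cx0.
  (* The appended column of ones gives opposite coefficients; comparing slopes then makes both
     vanish. *)
  have cE0 : c 0 0 = - c 0 i1 by lra.
  have : c 0 i1 * (slope xr - slope xl) = 0.
    by rewrite cE0 in cx0 cx1; rewrite /slope; lra.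
  move=> /eqP; rewrite mulf_eq0 subr_eq0 (gt_eqF sP) orbF => /eqP c10.
  apply/rowP => j; rewrite mxE; have [->|->] : j = 0 \/ j = i1; last exact: c10.
    by case: j => -[|[|//]] ?; [left|right]; exact: val_inj.
  by rewrite cE0 c10 oppr0.
move=> l l' lls l'ls F [-> [x [v [[Ux xl] [Uv vl] xv]]]] [FE _].
(* Two points of different slopes can have equal weighted values at only one weight. *)
have [_ xl'] : support_set l' x by rewrite -FE.
have [_ vl'] : support_set l' v by rewrite -FE.
move: xl' vl'; rewrite -(subrK l l') addrC !weightedD xl vl => <- /addrI/eqP.
rewrite -subr_eq0 -mulrBl mulf_eq0 subr_eq0 (gt_eqF xv) /= subr_eq0 => /eqP.
by rewrite addrC subrK.
Qed.

End PlanarPareto.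

(** * Reachability within a bounded horizon, and its limit *)

Lemma measure_bigcup_finType (d : measure_display) (T : measurableType d)
    (R : realType) (mu : {measure set T -> \bar R}) (I : finType)
    (F : I -> set T) :
  (forall i, measurable (F i)) -> trivIset setT F ->
  mu (\bigcup_i F i) = (\sum_i mu (F i))%E.
Proof.
move=> mF tF; rewrite measure_fin_bigcup //; last exact: finite_finset.
rewrite [RHS]fsbig_seq ?index_enum_uniq //; congr (\big[_/_]_(i \in _) _).
by apply/seteqP; split => i //= _; rewrite mem_index_enum.
Qed.

Section Histories.
Variable M : mdp.
Implicit Types (h : history M) (P : {set state M}) (r : run M).

Lemma cylinderP (x0 : state M * action M) h r :
  cylinder h r <-> (forall i, (i < size h.1)%N -> r i = nth x0 h.1 i) /\
                   (r (size h.1)).1 = h.2.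
Proof.
split=> -[rE rl]; split => //.
  by move=> i ih; rewrite (rE (Ordinal ih)) (tnth_nth x0).
by move=> i; rewrite rE // (tnth_nth x0).
Qed.

Lemma cylinder_rcons s v a w r : cylinder (rcons s (v, a), w) r <->
  cylinder (s, v) r /\ ((r (size s)).2, (r (size s).+1).1) = (a, w).
Proof.
rewrite !(cylinderP (v, a)) /= size_rcons; split.
- case=> rE rw; have rs := rE _ (ltnSn _).
  rewrite nth_rcons ltnn eqxx in rs; rewrite rw rs; split=> //; split=> // i si.
  by rewrite rE ?nth_rcons ?si // ltnW.
- case=> -[rE rv] [ra rw]; split => // i; rewrite ltnS leq_eqVlt nth_rcons.
  case/predU1P=> [->|si]; first by rewrite ltnn eqxx -rv -ra -surjective_pairing.
  by rewrite si rE.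
Qed.

Lemma cylinder_cons x s w r : cylinder (x :: s, w) r <->
  r 0 = x /\ cylinder (s, w) (fun i => r i.+1).
Proof.
rewrite !(cylinderP x) /=; split.
  by case=> rE rw; split; [exact: (rE 0%N)|split => // i si; exact: (rE i.+1)].
by case=> r0 [rE rw]; split => // -[|i] // si; rewrite rE.
Qed.

Lemma measurable_cylinder h : measurable (cylinder h : set (run M)).
Proof. by apply: sub_sigma_algebra; exists h. Qed.

(** Only visits from the last state of [h] onwards count, which gives a one-step recursion in
    [i]. *)
Definition reach_within P h i : set (run M) :=
  [set r | cylinder h r /\
    exists2 j, (size h.1 <= j <= size h.1 + i)%N & (r j).1 \in P].

Lemma reach_withinS P h i : h.2 \notin P ->
  reach_within P h i.+1 =
  \bigcup_(p : action M * state M) reach_within P (rcons h.1 (h.2, p.1), p.2) i.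
Proof.
move=> hP; apply/seteqP; split => r.
- case=> hr [j /andP[hj ji] jP].
  exists ((r (size h.1)).2, (r (size h.1).+1).1) => //; split.
    by apply/cylinder_rcons; split; last by []; case: (h) hr.
  exists j => //=; rewrite size_rcons addSnnS ji andbT ltn_neqAle hj andbT.
  apply: contra hP => /eqP hjE; move: jP; rewrite -hjE.
  by case: hr => _ ->.
- case=> -[a w] _ [/cylinder_rcons[hr _] [j]].
  rewrite /= size_rcons => /andP[hj ji] jP; split.
    by case: (h) hr.
  by exists j => //; rewrite ltnW //= -addSnnS.
Qed.

End Histories.

Section InducedMeasure.
Variables (R : realType) (M : mdp) (sigma : strategy R M) (u : state M).
Implicit Types (h : history M) (P : {set state M}).

Lemma hist_probE (x0 : state M * action M) h : hist_prob sigma u h =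
  (hist_state h 0 == u)%:R * \prod_(0 <= i < size h.1)
    (strat_prob sigma (take i h.1, (nth x0 h.1 i).1) (nth x0 h.1 i).2 *
     ratr (trans (nth x0 h.1 i).1 (nth x0 h.1 i).2 (hist_state h i.+1))).
Proof.
rewrite /hist_prob big_mkord; congr (_ * _); apply: eq_bigr => i _.
by rewrite (tnth_nth x0) /=; case: (nth _ _ _).
Qed.

Lemma hist_state_rcons s v a w i : (i <= size s)%N ->
  hist_state ((rcons s (v, a), w) : history M) i = hist_state (s, v) i.
Proof.
rewrite /hist_state /= /unzip1 map_rcons nth_rcons size_map leq_eqVlt.
case/predU1P => [->|lt_i]; first by rewrite ltnn eqxx nth_default // size_map.
by rewrite lt_i; apply: set_nth_default; rewrite size_map.
Qed.

Lemma hist_prob_rcons s v a w : hist_prob sigma u (rcons s (v, a), w) =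
  hist_prob sigma u (s, v) *
  (strat_prob sigma (s, v) a * ratr (trans v a w)).
Proof.
rewrite !(hist_probE (v, a)) hist_state_rcons //= size_rcons big_nat_recr //=.
rewrite mulrA; congr (_ * _ * _).
  apply: eq_big_nat => i /andP[_ lt_i]; rewrite nth_rcons lt_i hist_state_rcons //.
  by rewrite -cats1 takel_cat // ltnW.
rewrite nth_rcons ltnn eqxx /= -cats1 takel_cat // take_size.
by rewrite /hist_state nth_default // /unzip1 size_map cats1 size_rcons.
Qed.

(* The probability, given the history [h], to visit [P] now or during the next
   [i] steps. *)
Fixpoint reach_prob P i h : R :=
  if h.2 \in P then 1 else
  if i is j.+1 then
    \sum_a strat_prob sigma h a *
      \sum_w ratr (trans h.2 a w) * reach_prob P j (rcons h.1 (h.2, a), w)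
  else 0.

Lemma reach_prob_in P i h : h.2 \in P -> reach_prob P i h = 1.
Proof. by case: i => [|i] /= ->. Qed.

Variable mu : probability (run M) R.
Hypothesis mu_ind : induced_measure sigma u mu.

(** By induction on the horizon. If the last state of [h] is in [P], the event is the whole
    cylinder; otherwise it splits into finitely many disjoint events, one for each next action and
    state. *)
Lemma reach_within_prob P i h :
  measurable (reach_within P h i) /\
  mu (reach_within P h i) =
    (hist_prob sigma u h * reach_prob P i h)%:E.
Proof.
elim: i h => [|i IH] h.
all: have [hP|hP] := boolP (h.2 \in P).
1,3: rewrite (_ : reach_within P h _ = cylinder h); first by
       rewrite reach_prob_in // mulr1 -mu_ind; split => //; exact: measurable_cylinder.
1,2: by apply/seteqP; split => [r []//|r [? rh]]; split => //;
       exists (size h.1); rewrite ?leqnn ?leq_addr // rh.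
- rewrite (_ : reach_within P h 0 = set0); last first.
    rewrite -subset0 => r [[_ rh] [j]]; rewrite addn0 -eqn_leq => /eqP <-.
    by rewrite rh (negbTE hP).
  by rewrite measure0 /= (negbTE hP) mulr0.
pose F (p : action M * state M) := reach_within P (rcons h.1 (h.2, p.1), p.2) i.
have FE p : measurable (F p) /\ mu (F p) =
    (hist_prob sigma u (rcons h.1 (h.2, p.1), p.2) *
     reach_prob P i (rcons h.1 (h.2, p.1), p.2))%:E.
  exact: IH.
rewrite reach_withinS //; split.
  by apply: fin_bigcup_measurable => [|p _]; [exact: finite_finset|have [] := FE p].
rewrite measure_bigcup_finType; last 2 first.
- by move=> p; have [] := FE p.
- move=> [a w] [a' w'] _ _ [r [[/cylinder_rcons[_ aw] _] [/cylinder_rcons[_ aw'] _]]].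
  by rewrite -aw -aw'.
rewrite (eq_bigr _ (fun p _ => (FE p).2)).
rewrite sumEFin; congr EFin; rewrite /= (negbTE hP) mulr_sumr.
under [RHS]eq_bigr do rewrite !mulr_sumr.
rewrite pair_big /=; apply: eq_bigr => -[a w] _ /=.
by rewrite hist_prob_rcons -surjective_pairing; ring.
Qed.

Lemma reach_bigcup P :
  reach P = \bigcup_i \bigcup_v reach_within P ([::], v) i.
Proof.
apply/seteqP; split => [r [i ri]|r [i _ [v _ [_ [j _ rj]]]]]; last by exists j.
exists i => //; exists (r 0).1 => //; split; last by exists i; rewrite ?leq0n ?add0n /=.
by split => //= -[].
Qed.

Lemma measurable_reach P : measurable (reach P).
Proof.
rewrite reach_bigcup; apply: bigcup_measurable => i _.
apply: fin_bigcup_measurable => [|v _]; first exact: finite_finset.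
by have [] := reach_within_prob P i ([::], v).
Qed.

Lemma hist_prob_nil v : hist_prob sigma u ([::], v) = (v == u)%:R.
Proof. by rewrite /hist_prob big_ord0 mulr1. Qed.

(** Up to the null set of runs that do not start in [u], [reach P] is the increasing union of the
    bounded-horizon events; continuity from below applies. *)
Lemma reach_prob_cvg P : (reach_prob P i ([::], u))%:E @[i --> \oo] --> mu (reach P).
Proof.
pose C := cylinder (([::], u) : history M) : set (run M).
have muC : mu C = 1%E by rewrite mu_ind hist_prob_nil eqxx.
have mC : measurable C := measurable_cylinder _.
have mreach := measurable_reach P.
have -> : mu (reach P) = mu (\bigcup_i reach_within P ([::], u) i).
  rewrite (_ : \bigcup_i _ = reach P `&` C); last first.
    apply/seteqP; split => [r [i _ [? [j _ rj]]]|r [[i ri] Cr]]; first by split => //; exists j.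
    by exists i => //; split => //; exists i; rewrite ?add0n ?leq0n /=.
  rewrite (measureDI mu mreach mC) [X in (X + _)%E](_ : _ = 0%E) ?add0e //.
  apply/eqP; rewrite eq_le measure_ge0 andbT.
  apply: (@le_trans _ _ (mu (~` C))).
    by apply: le_measure; rewrite ?inE; [exact: measurableD|exact: measurableC|move=> r []].
  by rewrite probability_setC // muC subee.
have GE i : (reach_prob P i ([::], u))%:E = mu (reach_within P ([::], u) i).
  by have [_ ->] := reach_within_prob P i ([::], u); rewrite hist_prob_nil eqxx mul1r.
under eq_fun do rewrite GE.
apply: (nondecreasing_cvg_mu (F := fun i => reach_within P ([::], u) i)).
- by move=> i; have [] := reach_within_prob P i ([::], u).
- by apply: bigcup_measurable => i _; have [] := reach_within_prob P i ([::], u).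
- move=> i j ij; apply/subsetPset => r [Cr [k /andP[_ ki] rk]]; split => //.
  by exists k => //=; apply: leq_trans ki _.
Qed.

(** Passing to the limit reduces bounds for arbitrary strategies to an induction on the horizon. *)
Lemma weighted_reach_le (P1 P2 : {set state M}) (l b : R) : 0 <= l <= 1 ->
  (forall i, l * reach_prob P1 i ([::], u) + (1 - l) * reach_prob P2 i ([::], u) <= b) ->
  l * fine (mu (reach P1)) + (1 - l) * fine (mu (reach P2)) <= b.
Proof.
move=> l01 le_b.
have cvgP P : reach_prob P i ([::], u) @[i --> \oo] --> (fine (mu (reach P)) : R).
  suff /fine_cvgP[] : (reach_prob P i ([::], u))%:E @[i --> \oo] -->
    (fine (mu (reach P)))%:E by [].
  rewrite fineK ?fin_num_measure //; [exact: reach_prob_cvg|exact: measurable_reach].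
have h : l * reach_prob P1 i ([::], u) + (1 - l) * reach_prob P2 i ([::], u)
    @[i --> \oo] --> (l * fine (mu (reach P1)) + (1 - l) * fine (mu (reach P2)) : R).
  by apply: cvgD; apply: cvgMr; exact: cvgP.
rewrite -(cvg_lim _ h) //; apply: limr_le; first by apply/cvg_ex; eexists; exact: h.
by near=> i; exact: le_b.
Unshelve. all: by end_near. Qed.

Lemma reach_prob_le P i : reach_prob P i ([::], u) <= fine (mu (reach P)).
Proof.
rewrite -lee_fin fineK ?fin_num_measure //; last exact: measurable_reach.
have [mG] := reach_within_prob P i ([::], u).
rewrite hist_prob_nil eqxx mul1r => <-.
apply: le_measure; rewrite ?inE //; first exact: measurable_reach.
by move=> r [_ [j _ rj]]; exists j.
Qed.

End InducedMeasure.

(** * Tools to build run measures: finite averages and prefixing a step *)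

Section MeasureAverage.
Context (d : measure_display) (T : measurableType d) (R : realType) (n : nat).
Variable m : 'I_n.+1 -> probability T R.

Definition measure_average :=
  msum (fun k => mscale ((n.+1%:R^-1 : R)%:nng) (m (inord k))) n.+1.

HB.instance Definition _ := Measure.on measure_average.

Lemma measure_averageE A :
  measure_average A = (\sum_(j < n.+1) (n.+1%:R^-1)%:E * m j A)%E.
Proof. by apply: eq_bigr => j _; rewrite /mscale inord_val. Qed.

Let measure_average_setT : measure_average [set: T] = 1%E.
Proof.
rewrite measure_averageE; under eq_bigr do rewrite probability_setT mule1.
by rewrite sumEFin sumr_const card_ord -[X in X%:E]mulr_natr mulVf.
Qed.

HB.instance Definition _ :=
  Measure_isProbability.Build _ _ _ measure_average measure_average_setT.

End MeasureAverage.

Section RunCons.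
Variable M : mdp.

Definition run_cons (x : state M * action M) (r : run M) : run M :=
  fun i => if i is j.+1 then r j else x.

Lemma preimage_run_cons_nil x v :
  run_cons x @^-1` (cylinder (([::], v) : history M)) = if x.1 == v then setT else set0.
Proof.
case: eqP => xv; apply/seteqP; split => //= r; last by case.
by move=> _; split => //= -[].
Qed.

Lemma preimage_run_cons x y s v :
  run_cons x @^-1` (cylinder ((y :: s, v) : history M)) =
  if x == y then cylinder (s, v) else set0.
Proof.
case: eqP => xy; apply/seteqP; split => //= r /=.
- by move/cylinder_cons => [].
- by move=> rc; apply/cylinder_cons.
- by move/cylinder_cons => [/xy].
Qed.

Lemma measurable_run_cons x : measurable_fun setT (run_cons x).
Proof.
apply: (@measurability _ _ (run M) (run M) setT (run_cons x)
  (range (@cylinder M) : set (set (run M)))) => // _ [_ [[[|y s] v] _ <-] <-].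
- by rewrite setTI preimage_run_cons_nil; case: ifP.
- by rewrite setTI preimage_run_cons; case: ifP => // _; exact: measurable_cylinder.
Qed.

HB.instance Definition _ x :=
  isMeasurableFun.Build _ _ _ _ (run_cons x) (measurable_run_cons x).

End RunCons.

(** * MDPs in which an action picks one of [k.+1] slots uniformly *)

Section UniformMdp.
Variables (n k : nat) (succ : 'I_n.+1 -> bool -> 'I_k.+1 -> 'I_n.+1).

Definition uniform_trans v a w : rat :=
  (\sum_(j < k.+1) (succ v a j == w)%:R) / k.+1%:R.

Lemma uniform_mdp_state_gt0 : (0 < #|'I_n.+1|)%N.
Proof. by rewrite card_ord. Qed.

Lemma uniform_mdp_enabled_neq0 (v : 'I_n.+1) : (finset.setTfor bool) != finset.set0.
Proof. by apply/set0Pn; exists true; rewrite finset.inE. Qed.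

Lemma uniform_trans_ge0 v a w : a \in (finset.setTfor bool) -> 0 <= uniform_trans v a w.
Proof. by move=> _; rewrite divr_ge0 // sumr_ge0. Qed.

(** An expectation over the next state is an average over the slots. The morphism [f] covers both
    rational and real probabilities. *)
Lemma uniform_trans_sum (F : fieldType) (f : {rmorphism rat -> F}) (g : 'I_n.+1 -> F) v a :
  \sum_w f (uniform_trans v a w) * g w = (\sum_j g (succ v a j)) / k.+1%:R.
Proof.
rewrite mulr_suml.
under eq_bigr => w _.
  rewrite rmorphM fmorphV rmorph_nat rmorph_sum -mulrA mulr_suml.
  under eq_bigr do rewrite rmorph_nat.
  over.
rewrite exchange_big /=; apply: eq_bigr => j _.
rewrite (bigD1 (succ v a j)) //= eqxx mul1r big1 ?addr0; first by rewrite mulrC.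
by move=> w /negbTE; rewrite eq_sym => ->; rewrite mul0r.
Qed.

Lemma uniform_trans_sum1 v a : a \in (finset.setTfor bool) -> \sum_w uniform_trans v a w = 1.
Proof.
move=> _; have := uniform_trans_sum (@idfun rat) (fun=> 1) v a.
under eq_bigr do rewrite mulr1.
by move=> ->; rewrite sumr_const card_ord mulfV.
Qed.

Definition uniform_mdp : mdp :=
  @Mdp _ bool (fun=> finset.setTfor bool) uniform_trans uniform_mdp_state_gt0
    uniform_mdp_enabled_neq0 uniform_trans_ge0 uniform_trans_sum1.

Variable R : realType.

Section Policy.
Variable policy : 'I_n.+1 -> bool.

Let policy_prob (h : history uniform_mdp) (a : bool) : R := (a == policy h.2)%:R.

Lemma policy_prob_ge0 h a : 0 <= policy_prob h a.
Proof. exact: ler0n. Qed.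

Lemma policy_prob_sum1 h : \sum_a policy_prob h a = 1.
Proof.
rewrite (bigD1 (policy h.2)) //= /policy_prob eqxx big1 ?addr0 // => a.
by move/negbTE ->.
Qed.

Lemma policy_prob_enabled (h : history uniform_mdp) a :
  a \notin enabled h.2 -> policy_prob h a = 0.
Proof. by rewrite finset.inE. Qed.

Definition policy_strategy : strategy R uniform_mdp :=
  Strategy policy_prob_ge0 policy_prob_sum1 policy_prob_enabled.

(** First-step decomposition: since the policy is memoryless, dropping the first step leaves the
    later choices unchanged. *)
Lemma policy_hist_prob_cons u v a s w :
  hist_prob policy_strategy u ((v, a) :: s, w) =
  (v == u)%:R * (a == policy v)%:R *
  ((\sum_j hist_prob policy_strategy (succ v a j) (s, w)) / k.+1%:R).
Proof.
rewrite -(uniform_trans_sum (ratr : {rmorphism rat -> R})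
  (fun v' => hist_prob policy_strategy v' (s, w))).
(* Only the next state with which the remaining history begins contributes. *)
rewrite (bigD1 (hist_state ((s, w) : history uniform_mdp) 0)) //= big1 ?addr0; last first.
  by move=> i /negbTE; rewrite /hist_prob eq_sym => ->; rewrite mul0r mulr0.
rewrite !(hist_probE _ _ (v, a)) /= big_nat_recl //= eqxx mul1r -!mulrA.
by congr (_ * (_ * (_ * _))); apply: eq_big_nat.
Qed.

Hypothesis succ_acyclic : forall v,
  (forall a j, succ v a j = v) \/ (forall a j, (succ v a j < v)%N).

Lemma policy_measure_exists (v : 'I_n.+1) :
  exists mu : probability (run uniform_mdp) R, induced_measure policy_strategy v mu.
Proof.
have [N] := ubnP v; elim: N v => // N IH v; rewrite ltnS => vN.
case: (succ_acyclic v) => [absorb|decr].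
  (* From an absorbing state the run is constant. *)
  exists (dirac ((fun=> (v, policy v)) : run uniform_mdp)) => -[s w].
  rewrite /= diracE; congr EFin; elim: s => [|[y a] s IHs].
    rewrite hist_prob_nil; congr ((nat_of_bool _)%:R); apply/idP/eqP; rewrite inE.
      by case.
    by move=> ->; split => // -[].
  rewrite policy_hist_prob_cons; case: eqP => [->|yv]; last first.
    rewrite !mul0r; case: (boolP (_ \in _)) => //; rewrite inE.
    by move=> /cylinder_cons[[/esym/yv]].
  case: eqP => [->|av]; last first.
    rewrite mulr0 mul0r; case: (boolP (_ \in _)) => //; rewrite inE.
    by move=> /cylinder_cons[[/esym/av]].
  under eq_bigr do rewrite absorb.
  rewrite sumr_const card_ord -(mulr_natr (hist_prob _ _ _)) mulfK // !mul1r -IHs.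
  congr ((nat_of_bool _)%:R); apply/idP/idP; rewrite !inE; first by move=> /cylinder_cons[].
  by move=> ?; apply/cylinder_cons.
have /choice[m mP] j : exists mu : probability (run uniform_mdp) R,
    induced_measure policy_strategy (succ v (policy v) j) mu.
  by apply: IH; apply: leq_trans vN; exact: decr.
(* Otherwise prefix the step [(v, policy v)] to the measures of the successors, which have smaller
   indices, and average over the slots. *)
exists (measure_average (fun j => distribution (m j) (@run_cons uniform_mdp (v, policy v)))).
move=> [s w]; rewrite /= measure_averageE /= /distribution /pushforward.
case: s => [|[y a] s].
  rewrite hist_prob_nil /= eq_sym.
  under eq_bigr do rewrite preimage_run_cons_nil /= (fun_if (m _)) probability_setT measure0.
  case: eqP => _; last by rewrite big1 // => j _; rewrite mule0.
  by rewrite sumEFin sumr_const card_ord mulr1 -[X in X%:E]mulr_natr mulVf.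
rewrite policy_hist_prob_cons.
under eq_bigr do rewrite preimage_run_cons (fun_if (m _)) measure0 mP.
rewrite xpair_eqE [v == y]eq_sym [_ == a]eq_sym; case: eqP => [->|_]; last first.
  by rewrite big1 ?mul0r // => j _; rewrite mule0.
case: eqP => [->|_] /=; last first.
  by rewrite big1 ?mulr0 ?mul0r // => j _; rewrite mule0.
rewrite !mul1r mulrC mulr_sumr sumEFin; congr EFin; exact: eq_bigr.
Qed.

End Policy.
End UniformMdp.

(** * The gadget and its optimality equation *)

(* State 0 is a sink; the states 3 k + 1, 3 k + 2 and 3 k + 3 are A_k, B_k and
   C_k.  The states below 4 are absorbing, and an action picks one of five
   successors uniformly. *)
Definition gadget_succ (v : nat) (a : bool) (j : 'I_5) : nat :=
  if (v < 4)%N then v else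
  nth 0%N
    (match (v %% 3)%N with
     | 1%N => rcons (nseq 4 (v - (if a then 3 else 2))%N) 0%N
     | 2%N => [:: v - 4; v - 4; v - 3; v - 3; v - 2]%N
     | _ => [:: (v - 3)%N]
     end) j.

Variant gadget_state_spec : nat -> Prop :=
  | GadgetLeaf v of (v < 4)%N : gadget_state_spec v
  | GadgetA k : gadget_state_spec (3 * k + 4)
  | GadgetB k : gadget_state_spec (3 * k + 5)
  | GadgetC k : gadget_state_spec (3 * k + 6).

Lemma gadget_stateP v : gadget_state_spec v.
Proof.
have [v4|v4] := ltnP v 4; first exact: GadgetLeaf.
pose k := ((v - 4) %/ 3)%N.
have : [\/ v = (3 * k + 4)%N, v = (3 * k + 5)%N | v = (3 * k + 6)%N].
  have : [|| v == 3 * k + 4, v == 3 * k + 5 | v == 3 * k + 6]%N by rewrite /k; lia.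
  by case/or3P => /eqP ?; [constructor 1|constructor 2|constructor 3].
by case=> ->; [exact: GadgetA|exact: GadgetB|exact: GadgetC].
Qed.

Lemma gadget_succ_leaf v a j : (v < 4)%N -> gadget_succ v a j = v.
Proof. by rewrite /gadget_succ => ->. Qed.

(** For C states only one slot is listed: the other four get the default value of [nth], the
    sink. *)
Lemma gadget_sum (R : nmodType) (F : nat -> R) v a : (4 <= v)%N ->
  \sum_(j < 5) F (gadget_succ v a j) =
  match (v %% 3)%N with
  | 1%N => F (v - (if a then 3 else 2))%N *+ 4 + F 0%N
  | 2%N => F (v - 4)%N *+ 2 + F (v - 3)%N *+ 2 + F (v - 2)%N
  | _ => F (v - 3)%N + F 0%N *+ 4
  end.
Proof.
move=> v4; rewrite /gadget_succ (leq_gtF v4) !big_ord_recl big_ord0 /=.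
case: (v %% 3)%N => [|[|[|?]]] /=; rewrite ?mulrS ?mulr0n ?addr0 ?addrA //.
Qed.

Lemma gadget_succ_lt v a j : (4 <= v)%N -> (gadget_succ v a j < v)%N.
Proof.
move=> v4; rewrite /gadget_succ (leq_gtF v4).
case: j => -[|[|[|[|[|//]]]]] _ /=; case: (v %% 3)%N => [|[|[|?]]] /=; case: a; lia.
Qed.

Section GadgetValue.
Variable R : realType.
Implicit Type l : R.

(** This undoes the scaling by 5^k; the value at C_k is 5^-k, since both leaf weights add up to
    1. *)
Definition gadget_value l (v : nat) : R :=
  if v is w.+1 then
    5 ^- (w %/ 3) *
    match (w %% 3)%N with
    | 0%N => (scaled_values (w %/ 3) l).1
    | 1%N => (scaled_values (w %/ 3) l).2
    | _ => 1
    end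
  else 0.

Lemma gadget_valueA l k :
  gadget_value l (3 * k + 1) = 5 ^- k * (scaled_values k l).1.
Proof.
rewrite addn1 /gadget_value.
have -> : (3 * k %/ 3 = k)%N by lia.
have -> : (3 * k %% 3 = 0)%N by lia.
by [].
Qed.

Lemma gadget_valueB l k :
  gadget_value l (3 * k + 2) = 5 ^- k * (scaled_values k l).2.
Proof.
rewrite addn2 /gadget_value.
have -> : ((3 * k).+1 %/ 3 = k)%N by lia.
have -> : ((3 * k).+1 %% 3 = 1)%N by lia.
by [].
Qed.

Lemma gadget_valueC l k : gadget_value l (3 * k + 3) = 5 ^- k.
Proof.
rewrite addn3 /gadget_value.
have -> : ((3 * k).+2 %/ 3 = k)%N by lia.
have -> : ((3 * k).+2 %% 3 = 2)%N by lia.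
by rewrite mulr1.
Qed.

Lemma scaled_values_ge0 k l : 0 <= l <= 1 ->
  0 <= (scaled_values k l).1 /\ 0 <= (scaled_values k l).2.
Proof.
move=> l01; elim: k => [|k] /=; first by split; lra.
case: (scaled_values k l) => a b /= [a0 b0]; split; last lra.
by rewrite mulr_ge0 // le_max a0.
Qed.

Lemma gadget_value_ge0 l v : 0 <= l <= 1 -> 0 <= gadget_value l v.
Proof.
move=> l01; case: v => // v; rewrite /gadget_value mulr_ge0 ?invr_ge0 ?exprn_ge0 //.
by have [? ?] := scaled_values_ge0 (v %/ 3) l01; case: (v %% 3)%N => [|[|]].
Qed.

Lemma gadget_value_leaf l v : (v < 4)%N ->
  gadget_value l v = l * (v \in [:: 1; 3])%:R + (1 - l) * (v \in [:: 2; 3])%:R.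
Proof. by case: v => [|[|[|[|//]]]] _; rewrite /gadget_value /= ?expr0 ?invr1; ring. Qed.

Definition gadget_greedy l (v : nat) : bool :=
  gadget_value l (v - 2) <= gadget_value l (v - 3).

(** The optimality equation with its defect: only a wrong choice at an A state loses value. It
    yields both the inequality for every action and the equality for the greedy one. *)
Lemma gadget_value_stepE l v a : (4 <= v)%N ->
  (\sum_(j < 5) gadget_value l (gadget_succ v a j)) / 5 =
  gadget_value l v -
  (v %% 3 == 1)%N%:R * (4 / 5) *
    (Num.max (gadget_value l (v - 3)) (gadget_value l (v - 2)) -
     gadget_value l (v - (if a then 3 else 2))).
Proof.
move=> v4; rewrite gadget_sum //; case: (gadget_stateP v) v4 => {v} [v|k|k|k] v4.
- by rewrite leqNgt v4.
- have -> : ((3 * k + 4) %% 3 = 1)%N by lia.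
  have -> : (3 * k + 4 - 3 = 3 * k + 1)%N by lia.
  have -> : (3 * k + 4 - 2 = 3 * k + 2)%N by lia.
  have -> : (3 * k + 4 - (if a then 3 else 2) = if a then 3 * k + 1 else 3 * k + 2)%N.
    by case: a; lia.
  have -> : (3 * k + 4 = 3 * k.+1 + 1)%N by lia.
  rewrite (fun_if (gadget_value l)) !gadget_valueA gadget_valueB /= exprS invfM.
  case: (scaled_values k l) => x y /=; set p := 5 ^- k.
  rewrite (_ : Num.max (p * x) (p * y) = p * Num.max x y); last first.
    by rewrite maxr_pMr // invr_ge0 exprn_ge0.
  by case: a; field.
- have -> : ((3 * k + 5) %% 3 = 2)%N by lia.
  have -> : (3 * k + 5 - 4 = 3 * k + 1)%N by lia.
  have -> : (3 * k + 5 - 3 = 3 * k + 2)%N by lia.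
  have -> : (3 * k + 5 - 2 = 3 * k + 3)%N by lia.
  have -> : (3 * k + 5 = 3 * k.+1 + 2)%N by lia.
  rewrite !gadget_valueA !gadget_valueB gadget_valueC /= exprS invfM.
  by case: (scaled_values k l) => x y /=; field.
- have -> : ((3 * k + 6) %% 3 = 0)%N by lia.
  have -> : (3 * k + 6 - 3 = 3 * k + 3)%N by lia.
  have -> : (3 * k + 6 = 3 * k.+1 + 3)%N by lia.
  by rewrite !gadget_valueC /= exprS invfM; field.
Qed.

Lemma gadget_value_le l v a : (4 <= v)%N ->
  (\sum_(j < 5) gadget_value l (gadget_succ v a j)) / 5 <= gadget_value l v.
Proof.
move=> v4; rewrite gadget_value_stepE // gerBl mulr_ge0 //.
by rewrite subr_ge0 le_max; case: a; rewrite lexx ?orbT.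
Qed.

Lemma gadget_value_greedy l v : (4 <= v)%N ->
  (\sum_(j < 5) gadget_value l (gadget_succ v (gadget_greedy l v) j)) / 5 =
  gadget_value l v.
Proof.
move=> v4; rewrite gadget_value_stepE // /gadget_greedy.
by case: leP => _; rewrite subrr mulr0 subr0.
Qed.

End GadgetValue.

(** * The support function of the achievable set of the gadget *)

Section Gadget.
Variable n : nat.

Lemma gadget_succ_leq (v : 'I_n.+1) a j : (gadget_succ v a j < n.+1)%N.
Proof.
have [v4|v4] := ltnP v 4; first by rewrite gadget_succ_leaf.
exact: ltn_trans (gadget_succ_lt a j v4) (ltn_ord v).
Qed.

Definition gadget_step (v : 'I_n.+1) (a : bool) (j : 'I_5) : 'I_n.+1 :=
  Ordinal (gadget_succ_leq v a j).

Definition gadget : mdp := uniform_mdp gadget_step.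

Definition gadget_target (s : seq nat) : {set state gadget} :=
  [set v : 'I_n.+1 | (v : nat) \in s]%SET.

Lemma gadget_target_notin s (v : 'I_n.+1) : (4 <= v)%N -> all (ltn^~ 4) s ->
  (v \in gadget_target s) = false.
Proof.
move=> v4 /allP s4; apply/negbTE; rewrite finset.inE; apply/negP => /s4 /=.
by rewrite ltnNge v4.
Qed.

Lemma gadget_step_acyclic (v : 'I_n.+1) :
  (forall a j, gadget_step v a j = v) \/ (forall a j, (gadget_step v a j < v)%N).
Proof.
have [v4|v4] := ltnP v 4; [left => a j|right => a j; exact: gadget_succ_lt].
by apply: val_inj; exact: gadget_succ_leaf.
Qed.

Section Values.
Variables (R : realType) (sigma : strategy R gadget).
Implicit Types (h : history gadget) (l : R) (s : seq nat).

Lemma gadget_reach_probS s i h : (4 <= h.2)%N -> all (ltn^~ 4) s ->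
  reach_prob sigma (gadget_target s) i.+1 h =
  \sum_a strat_prob sigma h a *
    ((\sum_j reach_prob sigma (gadget_target s) i
        (rcons h.1 (h.2, a), gadget_step h.2 a j)) / 5).
Proof.
move=> h4 s4 /=; rewrite gadget_target_notin //.
apply: eq_bigr => a _; congr (_ * _).
exact: (uniform_trans_sum gadget_step (ratr : {rmorphism rat -> R})
  (fun w => reach_prob sigma (gadget_target s) i (rcons h.1 (h.2, a), w))).
Qed.

Lemma gadget_reach_prob_leaf s i h : (h.2 < 4)%N ->
  reach_prob sigma (gadget_target s) i h = ((h.2 : nat) \in s)%:R.
Proof.
elim: i h => [|i IH] h h4 /=; rewrite finset.inE; case: ifP => // hs.
apply: big1 => a _.
rewrite (uniform_trans_sum gadget_step (ratr : {rmorphism rat -> R})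
  (fun w => reach_prob sigma (gadget_target s) i (rcons h.1 (h.2, a), w))).
rewrite big1 ?mul0r ?mulr0 // => j _.
by rewrite IH /= gadget_succ_leaf // hs.
Qed.

Definition gadget_reach_value l i h :=
  l * reach_prob sigma (gadget_target [:: 1; 3]%N) i h +
  (1 - l) * reach_prob sigma (gadget_target [:: 2; 3]%N) i h.

Lemma gadget_reach_valueS l i h : (4 <= h.2)%N ->
  gadget_reach_value l i.+1 h = \sum_a strat_prob sigma h a *
    ((\sum_j gadget_reach_value l i (rcons h.1 (h.2, a), gadget_step h.2 a j)) / 5).
Proof.
move=> h4; rewrite /gadget_reach_value !gadget_reach_probS // !mulr_sumr -big_split /=.
by apply: eq_bigr => a _; rewrite big_split /= -!mulr_sumr; ring.
Qed.

Lemma gadget_reach_value_leaf l i h : (h.2 < 4)%N ->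
  gadget_reach_value l i h = gadget_value l h.2.
Proof.
by move=> h4; rewrite /gadget_reach_value !gadget_reach_prob_leaf // gadget_value_leaf.
Qed.

(** [gadget_value] does not increase on average under any action, so induction on the horizon bounds
    every strategy, even randomized and history-dependent. *)
Lemma gadget_reach_value_le l i h : 0 <= l <= 1 ->
  gadget_reach_value l i h <= gadget_value l h.2.
Proof.
move=> l01; elim: i h => [|i IH] h.
all: have [h4|h4] := ltnP h.2 4; first by rewrite gadget_reach_value_leaf.
  rewrite /gadget_reach_value /= !gadget_target_notin // !mulr0 addr0.
  exact: gadget_value_ge0.
rewrite gadget_reach_valueS //.
rewrite -[leRHS]mul1r -[X in _ <= X * _](strat_sum1 sigma h) mulr_suml.
apply: ler_sum => a _; apply: ler_wpM2l; first exact: strat_ge0.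
apply: le_trans (gadget_value_le l a h4).
rewrite ler_pM2r ?invr_gt0 //; apply: ler_sum => j _; exact: IH.
Qed.

End Values.

(** Each step from a non-absorbing state lowers the index, so a horizon equal to the index suffices
    to reach a leaf. *)
Lemma gadget_reach_value_greedy (R : realType) (l : R) i (h : history gadget) :
  (h.2 <= i)%N ->
  gadget_reach_value
    (policy_strategy gadget_step R (fun v : 'I_n.+1 => gadget_greedy l v)) l i h =
  gadget_value l h.2.
Proof.
elim: i h => [|i IH] h hi.
  by rewrite gadget_reach_value_leaf // ltnS (leq_trans hi).
have [h4|h4] := ltnP h.2 4; first by rewrite gadget_reach_value_leaf.
rewrite gadget_reach_valueS // (bigD1 (gadget_greedy l h.2)) //= eqxx mul1r.
rewrite [X in _ + X]big1 ?addr0; last by move=> a /negbTE ->; rewrite mul0r.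
rewrite -[RHS]gadget_value_greedy //; congr (_ / _); apply: eq_bigr => j _.
by rewrite IH //= -ltnS (leq_trans _ hi) // gadget_succ_lt.
Qed.

Section Achievable.
Variables (R : realType) (u : state gadget).

Definition gadget_achievable : set 'rV[R]_2 :=
  achievable u [tuple reach (gadget_target [:: 1; 3]%N); reach (gadget_target [:: 2; 3]%N)].

Lemma gadget_achievable_le x l : gadget_achievable x -> 0 <= l <= 1 ->
  weighted l x <= gadget_value l u.
Proof.
move=> [_ [sigma [mu [mu_ind mu_ge]]]] l01.
have fin P : mu (reach P) \is a fin_num.
  by rewrite fin_num_measure //; exact: measurable_reach mu_ind _.
have x0 : x 0 0 <= fine (mu (reach (gadget_target [:: 1; 3]%N))).
  by rewrite -lee_fin fineK //; exact: mu_ge 0.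
have x1 : x 0 1 <= fine (mu (reach (gadget_target [:: 2; 3]%N))).
  by rewrite -lee_fin fineK //; exact: mu_ge 1.
apply: le_trans (weighted_reach_le mu_ind l01 (b := gadget_value l u) _); last first.
  by move=> i; exact: (gadget_reach_value_le sigma i ([::], u) l01).
by rewrite /weighted lerD // ler_wpM2l //; lra.
Qed.

Lemma gadget_achievable_attains l : 0 <= l <= 1 ->
  exists2 x, gadget_achievable x & weighted l x = gadget_value l u.
Proof.
move=> l01.
pose sigma := policy_strategy gadget_step R (fun v : 'I_n.+1 => gadget_greedy l v).
have [mu mu_ind] := policy_measure_exists R (fun v : 'I_n.+1 => gadget_greedy l v)
  gadget_step_acyclic u.
have fin P : mu (reach P) \is a fin_num.
  by rewrite fin_num_measure //; exact: measurable_reach mu_ind _.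
pose t i := fine (mu (reach (gadget_target
  (if i == 0 :> 'I_2 then [:: 1; 3]%N else [:: 2; 3]%N)))).
have Ux : gadget_achievable (\row_i t i).
  split=> [i|]; first by rewrite mxE fine_ge0.
  exists sigma, mu; split => // i; rewrite mxE fineK //.
  by case: i => -[|[|//]] ?; rewrite (tnth_nth set0).
exists (\row_i t i) => //; apply/eqP; rewrite eq_le gadget_achievable_le //=.
(* The horizon [u] already collects the full value, and unbounded reachability is at least as
   likely. *)
rewrite -(@gadget_reach_value_greedy R l u ([::], u)) //= /weighted !mxE /t /=.
by rewrite /gadget_reach_value lerD // ler_wpM2l ?(reach_prob_le mu_ind) //; lra.
Qed.

End Achievable.
End Gadget.

(** * Exponentially many vertices and facets *)

Lemma kinkZ (R : realType) (c : R) f l : 0 < c -> kink f l -> kink (fun y => c * f y) l.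
Proof.
move=> c0 [e [s [s' [e0 ss' fP]]]]; exists e, (c * s), (c * s'); split => //.
  by rewrite ltr_pM2l.
by move=> t /fP[-> ->]; split; ring.
Qed.

(** The initial state is A_(k+1), whose value has a kink at (1 + x) / 2 for each of the 2^k zeros
    [x]. *)
Lemma gadget_pareto (R : realType) n (u : state (gadget n)) k : (u : nat) = (3 * k + 4)%N ->
  (`I_(2 ^ k) #<= pareto_vertices (@gadget_achievable n R u))%card /\
  (`I_(2 ^ k) #<= pareto_facets (@gadget_achievable n R u))%card.
Proof.
move=> uE; pose ls : seq R := [seq (1 + x) / 2 | x <- tent_zeros R k].
have szls : size ls = (2 ^ k)%N by rewrite size_map size_tent_zeros.
have uls : uniq ls by rewrite map_inj_uniq ?tent_zeros_uniq // => x y; lra.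
have ls01 : {in ls, forall l, 0 < l < 1}.
  by move=> _ /mapP[x /tent_zeros_itv x1 ->]; lra.
have lsk : {in ls, forall l, kink ((@gadget_value R)^~ u) l}.
  move=> _ /mapP[x /scaled_values_kink xk ->]; rewrite uE.
  rewrite (_ : _^~ _ = fun y => 5 ^- k.+1 * (scaled_values k.+1 y).1).
    by apply: kinkZ xk; rewrite invr_gt0 exprn_gt0.
  by apply/funext => y; rewrite -gadget_valueA; congr gadget_value; lia.
have Ule := @gadget_achievable_le n R u.
have Uattains := @gadget_achievable_attains n R u.
rewrite -szls; split.
  exact: (kink_vertices Ule Uattains uls ls01 lsk).
exact: (kink_facets Ule Uattains uls ls01 lsk).
Qed.

(** * Encoding size and growth estimates *)

Lemma rat_size_fifths c : (c <= 5)%N -> (rat_size (c%:R / 5) <= 6)%N.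
Proof. by case: c => [|[|[|[|[|[|//]]]]]] _; vm_compute. Qed.

(** Per state: 3 for the state and its two label bits, and 70 for two actions with at most five
    transitions of cost at most 7 each. *)
Lemma gadget_size n s1 s2 :
  (mdp_size [:: gadget_target n s1; gadget_target n s2] <= 73 * n.+1)%N.
Proof.
have row_le (v : 'I_n.+1) a : (\sum_(w | (uniform_trans (@gadget_step n) v a w != 0)%R)
    (1 + rat_size (uniform_trans (@gadget_step n) v a w)) <= 35)%N.
  have le7 w : (1 + rat_size (uniform_trans (@gadget_step n) v a w) <= 7)%N.
    rewrite /uniform_trans -natr_sum; apply: rat_size_fifths.
    by rewrite -[leqRHS]card_ord -sum1_card leq_sum // => j _; case: eqP.
  (* Each transition of nonzero probability is charged to a slot leading to its target. *)
  apply: (@leq_trans (\sum_w \sum_(j < 5) (gadget_step v a j == w) * 7)); last first.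
    rewrite exchange_big /=.
    apply: (@leq_trans (\sum_(j < 5) 7)); last by rewrite sum_nat_const card_ord.
    apply: leq_sum => j _; rewrite (bigD1 (gadget_step v a j)) //= eqxx big1 //.
    by move=> w /negbTE; rewrite eq_sym => ->.
  rewrite big_mkcond; apply: leq_sum => w _; case: ifP => // tw.
  have [j jw|none] := pickP (fun j => gadget_step v a j == w).
    by rewrite (bigD1 j) //= jw mul1n; apply: leq_trans (le7 w) (leq_addr _ _).
  by move: tw; rewrite /uniform_trans big1 ?mul0r ?eqxx // => j _; rewrite none.
rewrite /mdp_size /= sum_nat_const card_ord (_ : 73 * n.+1 = n.+1 * 3 + n.+1 * 70)%N; last by lia.
rewrite leq_add2l.
apply: (@leq_trans (\sum_(v < n.+1) 70)); last by rewrite sum_nat_const card_ord.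
apply: leq_sum => v _.
apply: (@leq_trans (\sum_(a : bool) 35)); last by rewrite sum_nat_const card_bool.
rewrite big_mkcond; apply: leq_sum => a _; case: ifP => // _; exact: row_le.
Qed.

(** Apply ln y <= y to the square root of [x]. *)
Lemma ln_sqr_le (R : realType) (x : R) : 1 <= x -> ln x * ln x <= 4 * x.
Proof.
move=> x1; have x0 : 0 <= x := le_trans ler01 x1.
have s0 : 0 < Num.sqrt x by rewrite sqrtr_gt0 (lt_le_trans ltr01).
have lnE : ln x = 2 * ln (Num.sqrt x).
  by rewrite -[in LHS](sqr_sqrtr x0) lnXn // mulr_natl.
have l0 : 0 <= ln x by exact: ln_ge0.
have ls : ln x <= 2 * Num.sqrt x by rewrite lnE ler_pM2l // ltW // ln_sublinear.
rewrite (_ : 4 * x = (2 * Num.sqrt x) * (2 * Num.sqrt x)) ?ler_pM //.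
by rewrite -[in LHS](sqr_sqrtr x0); ring.
Qed.

(** The power is the exponential of (ln 2 / 24) (ln n)^2, and (ln n)^2 <= 4 n <= 24 k. *)
Lemma quasipoly_le_expn (R : realType) n k : (0 < n)%N -> (n <= 6 * k)%N ->
  n%:R `^ (ln 2 / 24 * ln n%:R) <= (2 ^ k)%:R :> R.
Proof.
move=> n0 nk; have n1 : 1 <= n%:R :> R by rewrite ler1n.
have nk' : n%:R <= 6 * k%:R :> R by rewrite -natrM ler_nat.
rewrite /powR pnatr_eq0 gtn_eqF // natrX -[X in X ^+ k](@lnK R) ?posrE //.
rewrite -expRM_natl ler_expR -mulrA.
have ln20 : 0 < ln 2 :> R by rewrite ln_gt0 // ltr1n.
apply: (@le_trans _ _ (ln 2 / 24 * (4 * n%:R))).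
  by rewrite ler_wpM2l ?ln_sqr_le // divr_ge0 // ltW.
have : ln 2 * n%:R <= ln 2 * (6 * k%:R) :> R by rewrite ler_pM2l.
by rewrite -mulr_natl; lra.
Qed.

Theorem theorem2p1 (R : realType) :
  exists (M : nat -> mdp) (P1 P2 : forall n, {set state (M n)})
         (u : forall n, state (M n)),
    (forall n : nat, (0 < n)%N -> #|state (M n)| = n) /\
    (exists C : nat, forall n : nat, (0 < n)%N ->
       (mdp_size [:: P1 n; P2 n] <= C * n)%N) /\
    (exists c : R, 0 < c /\
       exists N : nat, forall n : nat, (N <= n)%N ->
         let U := @achievable R (M n) (u n) 2
                    [tuple reach (P1 n); reach (P2 n)] in
         card_ge (pareto_vertices U) (n%:R `^ (c * ln n%:R)) /\
         card_ge (pareto_facets U) (n%:R `^ (c * ln n%:R))).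
Proof.
(* [gadget m] has [m.+1] states, hence the predecessor. The initial state chosen below is the last A
   state that fits when [n] is at least 5. *)
exists (fun n => gadget n.-1), (fun n => gadget_target n.-1 [:: 1; 3]%N),
  (fun n => gadget_target n.-1 [:: 2; 3]%N),
  (fun n => inord (3 * ((n - 5) %/ 3) + 4) : state (gadget n.-1)).
split; first by move=> n n0; rewrite card_ord prednK.
split; first by exists 73 => n n0; rewrite -[leqRHS](_ : 73 * n.-1.+1 = _)%N ?gadget_size ?prednK.
exists (ln 2 / 24); split; first by rewrite divr_gt0 // ln_gt0 // ltr1n.
(* From 3 k >= n - 7 one gets 6 k >= 2 n - 14, which is at least [n] once [n] is at least 14. *)
exists 14 => n n14; pose k := ((n - 5) %/ 3)%N.
have [|vert fac] := @gadget_pareto R n.-1 (inord (3 * k + 4)) k.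
  by rewrite inordK // prednK; [rewrite /k; lia|lia].
have le_n : n%:R `^ (ln 2 / 24 * ln n%:R) <= (2 ^ k)%:R :> R.
  by apply: quasipoly_le_expn; rewrite /k; lia.
by split; exists (2 ^ k)%N.
Qed.
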